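(* Let $\mathcal{P}$ be a projective plane whose set of points $\mathsf{P}$ is infinite, let $\infty$ be a symbol not in $\mathsf{P}$, and put $\mathsf{P}_\infty=\mathsf{P}\cup\{\infty\}$. Let $\mathbf{M}$ be a finite algebra with a binary term operation $\cdot$ and elements $\mathsf{a},\mathsf{b},\mathsf{c},\mathsf{d},\mathsf{e},\mathsf{f}$ (not necessarily distinct) such that $$\mathsf{a}\cdot\mathsf{c}=\mathsf{e},\qquad \mathsf{a}\cdot\mathsf{d}=\mathsf{b}\cdot\mathsf{c}=\mathsf{b}\cdot\mathsf{d}=\mathsf{f}.$$ For each line $L$ of $\mathcal{P}$ let $\mathsf{b}_{\infty,L}^{\mathsf{a},\mathsf{a}}\in M^{\mathsf{P}_\infty}$ be the tuple equal to $\mathsf{a}$ at every coordinate in $L\cup\{\infty\}$ and equal to $\mathsf{b}$ at all other coordinates, and let $\mathsf{d}_{\infty,L}^{\mathsf{c},\mathsf{c}}\in M^{\mathsf{P}_\infty}$ be the tuple equal to $\mathsf{c}$ at every coordinate in $L\cup\{\infty\}$ and equal to $\mathsf{d}$ at all other coordinates. Let $g\in M^{\mathsf{P}_\infty}$ be the tuple with $g(\infty)=\mathsf{e}$ and $g(q)=\mathsf{f}$ for all $q\in\mathsf{P}$. If the subalgebra of $\mathbf{M}^{\mathsf{P}_\infty}$ generated by $$\{\mathsf{b}_{\infty,L}^{\mathsf{a},\mathsf{a}},\ \mathsf{d}_{\infty,L}^{\mathsf{c},\mathsf{c}}\mid L\text{ a line of }\mathcal{P}\}$$ does not contain $g$,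 then $\mathbf{M}$ is inherently nondualisable.
   Context: Projective plane: a set $\mathsf{P}$ of points with a family of subsets of $\mathsf{P}$ called lines, such that any two distinct points lie on a unique common line, any two distinct lines meet in a unique point, and there are four points no three of which lie on a common line. Duality notions. Let $\mathbf{M}$ be a finite algebra and $\mathcal{Q}=\mathsf{ISP}(\mathbf{M})$ the quasivariety it generates (isomorphic copies of subalgebras of direct powers of $\mathbf{M}$). An alter ego $\mathbb{M}$ of $\mathbf{M}$ is a structure on the same universe $M$, carrying the discrete topology and some finitary operations, partial operations and relations, such that each $n$-ary operation is a homomorphism $\mathbf{M}^n\to\mathbf{M}$, each $n$-ary relation is a subalgebra of $\mathbf{M}^n$, and each $n$-ary partial operation is a homomorphism from a subalgebra of $\mathbf{M}^n$ into $\mathbf{M}$. Let $\mathcal{X}=\mathsf{IS_cP^+}(\mathbb{M})$ be the class of topologically and algebraically isomorphic copies of closed substructures of powers of $\mathbb{M}$ over nonempty index sets (product topology, pointwise structure). For $\mathbf{A}\in\mathcal{Q}$, $D(\mathbf{A})=\hom(\mathbf{A},\mathbf{M})$, a closed substructure of $\mathbb{M}^A$; for $\mathbb{A}\in\mathcal{X}$, $E(\mathbb{A})$ is the algebra of continuous homomorphisms (structure-preserving maps) $\mathbb{A}\to\mathbb{M}$, a subalgebra of $\mathbf{M}^{\mathbb{A}}$. $\mathbb{M}$ yields a duality on $\mathbf{A}$ if the (always injective) evaluation homomorphism $e:\mathbf{A}\to E(D(\mathbf{A}))$, $e_a(x)=x(a)$, is an isomorphism. $\mathbf{M}$ is dualisable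 (admits a natural duality) if some alter ego of $\mathbf{M}$ yields a duality on every $\mathbf{A}\in\mathcal{Q}$; otherwise it is nondualisable. A finite algebra $\mathbf{M}$ is inherently nondualisable if $\mathbf{M}\notin\mathsf{ISP}(\mathbf{N})$ for every finite dualisable algebra $\mathbf{N}$. *)

(* Defs.v *)
From HB Require Import structures.
From mathcomp Require Import all_boot.
From mathcomp Require Import all_classical.
From mathcomp Require Import topology.

Set Implicit Arguments.
Unset Strict Implicit.
Unset Printing Implicit Defensive.

Local Open Scope classical_set_scope.

(* Lines are genuine subsets of the point set, so that "distinct lines" is
   plain inequality of sets. *)
Record projective_plane (P : Type) := ProjectivePlane {
  is_line : set (set P);
  line_through : forall p q : P, p <> q ->
    exists! L : set P, is_line L /\ L p /\ L q;
  line_meet : forall L K : set P, is_line L -> is_line K -> L <> K ->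
    exists! p : P, L p /\ K p;
  quadrangle : exists p : 'I_4 -> P, injective p /\
    forall (i j k : 'I_4) (L : set P), i <> j -> i <> k -> j <> k ->
      is_line L -> ~ (L (p i) /\ L (p j) /\ L (p k))
}.

Record signature := Signature {
  op : Type;
  arity : op -> nat
}.

(* The universe may be empty; nonemptiness is required explicitly in
   [finite_algebra] and [ISP] and in the alter ego. *)
Record algebra (S : signature) := Algebra {
  carrier :> Type;
  interp : forall o : op S, ('I_(arity o) -> carrier) -> carrier
}.

Arguments interp {S} a o x.

Section Algebras.
Variable S : signature.
Implicit Types A B M : algebra S.

Definition finite_algebra M := finite_set [set: M] /\ [set: M] !=set0.

Definition is_hom A B (f : A -> B) :=
  forall (o : op S) (x : 'I_(arity o) -> A), f (interp A o x) = interp B o (f \o x).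

Definition is_iso A B (f : A -> B) := is_hom f /\ bijective f.

Definition isomorphic A B := exists f : A -> B, is_iso f.

Definition power (I : Type) A : algebra S :=
  @Algebra S (I -> A) (fun o x i => interp A o (fun k => x k i)).

Definition subuniverse A (U : set A) :=
  forall (o : op S) (x : 'I_(arity o) -> A), (forall k, U (x k)) -> U (interp A o x).

Definition subalgebra A (U : set A) (hU : subuniverse U) : algebra S :=
  @Algebra S (set_type U) (fun o x =>
    exist _ (interp A o (fun k => val (x k)))
            (mem_set (hU o _ (fun k => set_valP (x k))))).

Definition generated A (X : set A) : set A := smallest (@subuniverse A) X.

Definition ISP M A :=
  exists (I : Type) (U : set (power I M)) (hU : subuniverse U),
    U !=set0 /\ isomorphic A (subalgebra hU).

Inductive term (V : Type) : Type :=
| Var of V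
| App (o : op S) of ('I_(arity o) -> term V).

Fixpoint eval A (V : Type) (v : V -> A) (t : term V) : A :=
  match t with
  | Var i => v i
  | App o ts => interp A o (fun k => eval v (ts k))
  end.

(* The first argument is the value of variable 0, the second of variable 1. *)
Definition binary_term_op A (t : term 'I_2) (x y : A) : A :=
  eval (fun i : 'I_2 => if i == ord0 then x else y) t.

End Algebras.

Record structure_type := StructureType {
  fsym : Type; fsym_arity : fsym -> nat;
  psym : Type; psym_arity : psym -> nat;
  rsym : Type; rsym_arity : rsym -> nat
}.

Record structure (T : structure_type) := Structure {
  space :> topologicalType;
  struct_op : forall s : fsym T, ('I_(fsym_arity s) -> space) -> space;
  struct_pdom : forall s : psym T, set ('I_(psym_arity s) -> space);
  struct_pop : forall s : psym T, set_type (@struct_pdom s) -> space;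
  struct_rel : forall s : rsym T, set ('I_(rsym_arity s) -> space)
}.

Arguments struct_op {T} s0 s x.
Arguments struct_pdom {T} s0 s.
Arguments struct_pop {T} s0 s x.
Arguments struct_rel {T} s0 s.

Section Structures.
Variable T : structure_type.
Implicit Types X Y : structure T.

Definition structure_hom X Y (phi : X -> Y) :=
  [/\ forall (s : fsym T) (x : 'I_(fsym_arity s) -> X),
        phi (struct_op X s x) = struct_op Y s (phi \o x),
      forall (s : psym T) (x : set_type (struct_pdom X s)),
        exists y : set_type (struct_pdom Y s),
          val y = phi \o val x /\ phi (struct_pop X s x) = struct_pop Y s y &
      forall (s : rsym T) (x : 'I_(rsym_arity s) -> X),
        struct_rel X s x -> struct_rel Y s (phi \o x)].

Definition power_pdom (I : Type) X (s : psym T) :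
    set ('I_(psym_arity s) -> prod_topology (fun _ : I => X)) :=
  [set x | forall i : I, struct_pdom X s (fun k => x k i)].

Definition power_pop (I : Type) X (s : psym T)
    (x : set_type (@power_pdom I X s)) : prod_topology (fun _ : I => X) :=
  fun i => struct_pop X s (exist _ (fun k => val x k i) (mem_set (set_valP x i))).

Definition structure_power (I : Type) X : structure T :=
  @Structure T (prod_topology (fun _ : I => X))
    (fun s x i => struct_op X s (fun k => x k i))
    (@power_pdom I X)
    (@power_pop I X)
    (fun s => [set x | forall i : I, struct_rel X s (fun k => x k i)]).

Definition substructure_closed X (U : set X) :=
  (forall (s : fsym T) (x : 'I_(fsym_arity s) -> X),
     (forall k, U (x k)) -> U (struct_op X s x)) /\
  (forall (s : psym T) (x : set_type (struct_pdom X s)),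
     (forall k, U (val x k)) -> U (struct_pop X s x)).

Section Substructure.
Variables (X : structure T) (U : set X) (hU : substructure_closed U).

Definition sub_fop (s : fsym T) (x : 'I_(fsym_arity s) -> set_type U) :
    set_type U :=
  exist _ (struct_op X s (fun k => val (x k)))
          (mem_set (hU.1 s _ (fun k => set_valP (x k)))).

Definition sub_pdom (s : psym T) : set ('I_(psym_arity s) -> set_type U) :=
  [set x | struct_pdom X s (fun k => val (x k))].

Definition sub_pop (s : psym T) (x : set_type (@sub_pdom s)) : set_type U :=
  let x' : set_type (struct_pdom X s) :=
    exist _ (fun k => val (val x k)) (mem_set (set_valP x)) in
  exist _ (struct_pop X s x') (mem_set (hU.2 s x' (fun k => set_valP (val x k)))).

(* [set_type U] carries the subspace topology. *)
Definition substructure : structure T :=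
  @Structure T (set_type U) sub_fop sub_pdom sub_pop
    (fun s => [set x | struct_rel X s (fun k => val (x k))]).

End Substructure.
End Structures.

Record alter_ego (S : signature) (M : algebra S) := AlterEgo {
  ego_type : structure_type;
  ego_fop : forall s : fsym ego_type, power 'I_(fsym_arity s) M -> M;
  ego_fop_hom : forall s, is_hom (@ego_fop s);
  ego_pdom : forall s : psym ego_type, set (power 'I_(psym_arity s) M);
  ego_pdom_sub : forall s, subuniverse (@ego_pdom s);
  ego_pdom_neq0 : forall s, @ego_pdom s !=set0;
  ego_pop : forall s : psym ego_type, subalgebra (@ego_pdom_sub s) -> M;
  ego_pop_hom : forall s, is_hom (@ego_pop s);
  ego_rel : forall s : rsym ego_type, set (power 'I_(rsym_arity s) M);
  ego_rel_sub : forall s, subuniverse (@ego_rel s);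
  ego_rel_neq0 : forall s, @ego_rel s !=set0
}.

Section Duality.
Variables (S : signature) (M : algebra S) (E : alter_ego M).

Definition ego_structure : structure (ego_type E) :=
  @Structure (ego_type E) (discrete_topology {classic M})
    (@ego_fop _ _ E) (@ego_pdom _ _ E) (@ego_pop _ _ E) (@ego_rel _ _ E).

Definition hom_set (A : algebra S) : set (structure_power A ego_structure) :=
  [set x | @is_hom S A M x].

Lemma hom_set_closed (A : algebra S) : substructure_closed (@hom_set A).
Proof.
split=> [s x hx o y|s x hx o y].
- rewrite -[RHS](@ego_fop_hom _ _ E s o (fun j k => x k (y j))) /=.
  by congr (ego_fop _); apply/funext => k; exact: hx.
- rewrite -[RHS](@ego_pop_hom _ _ E s o (fun j => exist _
    (fun k => val x k (y j)) (mem_set (set_valP x (y j))))) /=.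
  by congr (ego_pop _); apply: val_inj; apply/funext => k; exact: hx.
Qed.

Definition dual (A : algebra S) : structure (ego_type E) :=
  substructure (@hom_set_closed A).

Definition cont_hom_set (X : structure (ego_type E)) : set (power X M) :=
  [set phi | continuous (phi : X -> ego_structure) /\
             @structure_hom _ X ego_structure phi].

Lemma cont_hom_set_sub (X : structure (ego_type E)) :
  subuniverse (@cont_hom_set X).
Proof.
move=> o phi hphi; split.
  move=> x; apply: (iffRL (@discrete_cvg (discrete_topology {classic M})
    (interp (power X M) o phi @ x) (interp (power X M) o phi x) _)).
  have near_eq k : nbhs x [set y | phi k y = phi k x].
    have [cphi _] := hphi k; apply: (cphi x [set phi k x]).
    exact: (@discrete_set1 (discrete_topology {classic M})).
  apply: filterS (filter_forall _ near_eq) => y /= eqy.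
  by congr (interp M o); apply/funext.
split=> [s x|s x|s x rx].
- rewrite -[RHS]/(ego_fop _) [RHS](@ego_fop_hom _ _ E s o
    (fun k i => phi k (x i))) /=.
  by congr (interp M o); apply/funext => k; have [_ [-> _ _]] := hphi k.
- have hy k : exists y : set_type (struct_pdom ego_structure s),
      val y = phi k \o val x /\ phi k (struct_pop X s x) = struct_pop ego_structure s y.
    by have [_ [_ + _]] := hphi k; apply.
  have /choice[y hyE] := hy.
  exists (interp (subalgebra (@ego_pdom_sub _ _ E s)) o y); split.
    by apply/funext => i /=; congr (interp M o); apply/funext => k;
       have [-> _] := hyE k.
  rewrite [RHS](@ego_pop_hom _ _ E s o y) /=.
  by congr (interp M o); apply/funext => k; have [_ ->] := hyE k.
- apply: (@ego_rel_sub _ _ E s o (fun k i => phi k (x i))) => k.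
  by have [_ [_ _]] := hphi k; apply.
Qed.

Definition dual_algebra (X : structure (ego_type E)) : algebra S :=
  subalgebra (@cont_hom_set_sub X).

Lemma evaluation_subproof (A : algebra S) (a : A) :
  cont_hom_set (fun x : dual A => val x a).
Proof.
split.
  move=> x; apply: (@continuous_comp (dual A) _ _ val
    (fun h : structure_power A ego_structure => h a)).
    exact: initial_continuous.
  exact: (@proj_continuous {classic A} (fun _ => ego_structure) a).
split=> [//|s x|s x rx]; last exact: (rx a).
exists (exist _ (fun k => val (val x k) a) (mem_set (set_valP x a))); split=> //.
by congr (ego_pop _); exact: val_inj.
Qed.

Definition evaluation (A : algebra S) (a : A) : dual_algebra (dual A) :=
  exist _ (fun x : dual A => val x a) (mem_set (@evaluation_subproof A a)).

Definition yields_duality (A : algebra S) := is_iso (@evaluation A).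

End Duality.

Section Dualisability.
Variable S : signature.

Definition dualisable (M : algebra S) :=
  exists E : alter_ego M, forall A : algebra S, ISP M A -> yields_duality E A.

Definition inherently_nondualisable (M : algebra S) :=
  forall N : algebra S, finite_algebra N -> dualisable N -> ~ ISP N M.

End Dualisability.

(* Coordinates are indexed by [option P], with [None] as the point at
   infinity; the tuple is [u] on L and at infinity, and [v] elsewhere. *)
Definition line_tuple (P M : Type) (u v : M) (L : set P) : option P -> M :=
  fun i => if i \in (Some @` L) `|` [set None] then u else v.

(* Main.v *)
(** If p is the point common to distinct lines L and K, the product of the
    generators b_L and d_K is the tuple g_p equal to e at infinity and at p, and
    to f elsewhere; the ghost g is the pointwise limit of the g_p.  Let x be a
    homomorphism from the generated algebra to a finite algebra N and colour each
    line L by the pair (x b_L, x d_L), so that x (g_p) depends only on the colours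
    of any two distinct lines through p.  Every point lies on two lines of one
    colour i, since infinitely many lines pass through it.  Unless p is the only
    such point for i, some line K of colour i misses another point r of that kind,
    and then all points of K have the same x-value as r; as any two lines meet,
    these values agree for all such colours.  Hence p |-> x (g_p) is constant off
    a set of at most |N|^2 points.  Sending x to this constant is locally an
    evaluation and, by the uniform bound, continuous on the dual of the generated
    algebra.  A duality on N would make it the evaluation at an element of the
    generated algebra, and that element could only be g. *)

From mathcomp Require Import topology.
Require Import Defs.
From mathcomp Require Import all_boot all_classical.

Set Implicit Arguments.
Unset Strict Implicit.
Unset Printing Implicit Defensive.
Local Open Scope classical_set_scope.

(** * Sequences in infinite sets and the pigeonhole principle *)

Lemma infinite_set_seq (T : Type) (A : set T) : infinite_set A ->
  exists s : nat -> T, injective s /\ forall n, A (s n).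
Proof.
move=> /[dup] /infinite_setN0[x0 _].
elim/Ppointed: T => T in A x0 *; first by case: (no x0).
move=> /infiniteP/ppcard_leP[f]; exists f.
split; last by move=> n; exact: (@funS _ _ setT A f).
by move=> m n; apply: inj; rewrite ?inE.
Qed.

Lemma finite_set_ord_inj (T : Type) : finite_set [set: T] ->
  exists (n : nat) (h : T -> 'I_n), injective h.
Proof.
move=> /finite_setP[n]; rewrite card_eq_le => /andP[/pcard_leP[f] _].
have fn x : (f x < n)%N by apply: (@funS _ _ [set: T] `I_n f).
exists n, (fun x => Ordinal (fn x)) => x y /(congr1 val) /= fxy.
by apply: (@inj _ _ _ f); rewrite ?inE.
Qed.

Lemma infinite_set_pigeonhole (T : Type) (C : finType) (A : set T) (h : T -> C) :
  infinite_set A -> exists x y, [/\ A x, A y, x <> y & h x = h y].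
Proof.
move=> /infinite_set_seq[s [s_inj As]]; apply: contrapT => noxy.
have hs_inj : injective (fun i : 'I_#|C|.+1 => h (s i)).
  move=> i j hij; apply/val_inj/s_inj; apply: contrapT => sij.
  by apply: noxy; exists (s i), (s j).
by have := leq_card _ hs_inj; rewrite card_ord ltnn.
Qed.

(** * Projective planes with infinitely many points *)

Section Plane.
Variables (P : Type) (PP : projective_plane P).

Lemma line_throughP (p q : P) : exists L : set P, [/\ is_line PP L, L p & L q].
Proof.
have [pq|npq] := pselect (p = q); last first.
  by have [L [[lL [Lp Lq]] _]] := line_through PP npq; exists L.
subst q; have [r npr] : exists r, p <> r.
  have [k [k_inj _]] := quadrangle PP.
  have [pk|] := pselect (p = k ord0); last by exists (k ord0).
  by exists (k ord_max); rewrite pk => /k_inj.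
by have [L [[lL [Lp Lr]] _]] := line_through PP npr; exists L.
Qed.

Lemma line_unique (p q : P) (L K : set P) : p <> q ->
  is_line PP L -> is_line PP K -> L p -> L q -> K p -> K q -> L = K.
Proof.
move=> npq lL lK Lp Lq Kp Kq.
have [H [_ uH]] := line_through PP npq.
by rewrite -(uH L) // -(uH K).
Qed.

Lemma meet_unique (p q : P) (L K : set P) :
  is_line PP L -> is_line PP K -> L <> K -> L p -> K p -> L q -> K q -> p = q.
Proof.
move=> lL lK nLK Lp Kp Lq Kq; apply: contrapT => npq.
by apply: nLK; exact: (line_unique npq).
Qed.

(** The case [L = K] amounts to lines being nonempty: [L] either is a line through a quadrangle
    point or meets that line. *)
Lemma meetP (L K : set P) : is_line PP L -> is_line PP K ->
  exists p : P, L p /\ K p.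
Proof.
move=> lL lK; have [<-|nLK] := pselect (L = K); last first.
  by have [p [Lp _]] := line_meet lL lK nLK; exists p.
have [i _] := quadrangle PP.
have [H [lH Hi _]] := line_throughP (i ord0) (i ord0).
have [LH|nLH] := pselect (L = H); first by exists (i ord0); rewrite LH.
by have [p [[Lp _] _]] := line_meet lL lH nLH; exists p.
Qed.

(** The diagonal point [u], where the lines [pr] and [qs] meet, works: on [L] it would be [p], on
    [K] it would be [r], and either way three of the four points become collinear. *)
Lemma diagonal_point_off (p q r s : P) (L K : set P) :
  p <> r -> q <> s ->
  (forall H, is_line PP H -> ~ (H p /\ H q /\ H r)) ->
  (forall H, is_line PP H -> ~ (H p /\ H q /\ H s)) ->
  (forall H, is_line PP H -> ~ (H p /\ H r /\ H s)) ->
  (forall H, is_line PP H -> ~ (H q /\ H r /\ H s)) ->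
  is_line PP L -> is_line PP K -> L p -> L q -> K r -> K s ->
  exists u, ~ L u /\ ~ K u.
Proof.
move=> npr nqs pqr pqs prs qrs lL lK Lp Lq Kr Ks.
have [A [lA Ap Ar]] := line_throughP p r.
have [B [lB Bq Bs]] := line_throughP q s.
have [u [Au Bu]] := meetP lA lB.
exists u; split=> [Lu|Ku].
- have up : u = p.
    apply: (@meet_unique _ _ L A) => // LA; apply: (pqr L) => //.
    by rewrite {3}LA.
  by apply: (pqs B) => //; rewrite -up.
- have ur : u = r.
    apply: (@meet_unique _ _ K A) => // KA; apply: (prs K) => //.
    by rewrite {1}KA.
  by apply: (qrs B) => //; rewrite -ur.
Qed.

Lemma point_off_lines (L K : set P) : is_line PP L -> is_line PP K ->
  exists u, ~ L u /\ ~ K u.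
Proof.
move=> lL lK; apply: contrapT => nou.
have LK u : L u \/ K u.
  have [|nL] := pselect (L u); first by left.
  by right; apply: contrapT => nK; apply: nou; exists u.
have [i [i_inj coll]] := quadrangle PP.
have [o0 [o1 [o2 [o3 [[n01 n02 n03] [n12 n13 n23]]]]]] :
    exists o0 o1 o2 o3 : 'I_4, [/\ o0 <> o1, o0 <> o2 & o0 <> o3] /\
      [/\ o1 <> o2, o1 <> o3 & o2 <> o3].
  by exists (@Ordinal 4 0 isT), (@Ordinal 4 1 isT), (@Ordinal 4 2 isT),
            (@Ordinal 4 3 isT).
have diag j k l m H G : j <> k -> j <> l -> j <> m -> k <> l -> k <> m ->
    l <> m -> is_line PP H -> is_line PP G ->
    H (i j) -> H (i k) -> G (i l) -> G (i m) -> exists u, ~ H u /\ ~ G u.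
  move=> njk njl njm nkl nkm nlm lH lG.
  apply: diagonal_point_off => //; try (by move=> /i_inj);
    by move=> ? ?; apply: coll.
have coll3 j k l H : j <> k -> j <> l -> k <> l -> is_line PP H ->
    H (i j) -> H (i k) -> H (i l) -> False.
  by move=> njk njl nkl lH Hj Hk Hl; apply: (coll j k l H).
have swap : (exists u, ~ K u /\ ~ L u) -> False.
  by move=> [u [? ?]]; apply: nou; exists u.
have := LK (i o0); have := LK (i o1); have := LK (i o2); have := LK (i o3).
(* Either three quadrangle points share a line, or they split two and two between [L] and [K], and a
   diagonal point lies off both. *)
move=> [H3|H3] [H2|H2] [H1|H1] [H0|H0]; first
 [ by apply: (coll3 o0 o1 o2 L) | by apply: (coll3 o0 o1 o3 L)
 | by apply: (coll3 o0 o2 o3 L) | by apply: (coll3 o1 o2 o3 L)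
 | by apply: (coll3 o0 o1 o2 K) | by apply: (coll3 o0 o1 o3 K)
 | by apply: (coll3 o0 o2 o3 K) | by apply: (coll3 o1 o2 o3 K)
 | by apply: nou; apply: (diag o0 o1 o2 o3)
 | by apply: nou; apply: (diag o0 o2 o1 o3) => // /esym
 | by apply: nou; apply: (diag o0 o3 o1 o2) => // /esym
 | by apply: swap; apply: (diag o0 o1 o2 o3)
 | by apply: swap; apply: (diag o0 o2 o1 o3) => // /esym
 | by apply: swap; apply: (diag o0 o3 o1 o2) => // /esym ].
Qed.

(** If every line passed through [u], so would the line joining [v] and [w], chosen so that [u],
    [v], [w] are not collinear. *)
Lemma line_off (u : P) : exists L, is_line PP L /\ ~ L u.
Proof.
apply: contrapT => noL.
have inL L : is_line PP L -> L u.
  by move=> lL; apply: contrapT => nLu; apply: noL; exists L.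
have [L [lL Lu _]] := line_throughP u u.
have [v [nLv _]] := point_off_lines lL lL.
have [K [lK Ku Kv]] := line_throughP u v.
have [w [nLw nKw]] := point_off_lines lL lK.
have [H [lH Hv Hw]] := line_throughP v w.
apply: nKw; have -> // : K = H.
by apply: (@line_unique u v) => //; [move=> uv; apply: nLv; rewrite -uv | exact: inL].
Qed.

(** Were [L] finite, projection from a point off both lines would make every line finite; but the
    lines joining a point [p] to the points of a line missing [p] cover the plane. *)
Lemma infinite_line (L : set P) : infinite_set [set: P] ->
  is_line PP L -> infinite_set L.
Proof.
move=> Pinf lL finL; apply: Pinf.
have fin_line K : is_line PP K -> finite_set K.
  move=> lK; have [w [nLw nKw]] := point_off_lines lL lK.
  have proj z : exists q, L z -> exists H, [/\ is_line PP H, H w, H z, H q & K q].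
    have [H [lH Hw Hz]] := line_throughP w z.
    by have [q [Hq Kq]] := meetP lH lK; exists q; exists H.
  have [f fP] := choice proj.
  apply: sub_finite_set (finite_image f finL) => q Kq.
  have [H [lH Hw Hq]] := line_throughP w q.
  have [z [Hz Lz]] := meetP lH lL.
  exists z => //; have [H' [lH' Hw' Hz' Hf' Kf]] := fP z Lz.
  have HH' : H = H'.
    by apply: (@line_unique w z) => // wz; apply: nLw; rewrite wz.
  apply: (@meet_unique _ _ H K) => //; last by rewrite HH'.
  by move=> HK; apply: nKw; rewrite -HK.
have [p _] := point_off_lines lL lL.
have [K [lK nKp]] := line_off p.
have /choice[J JP] := line_throughP p.
apply: (@sub_finite_set _ _ (\bigcup_(z in K) J z)); last first.
  by apply: bigcup_finite => [|z _]; apply: fin_line => //; case: (JP z).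
move=> q _; have [H [lH Hp Hq]] := line_throughP p q.
have [z [Hz Kz]] := meetP lH lK.
exists z => //; have [lJ Jp Jz] := JP z; suff <- : H = J z by [].
by apply: (@line_unique p z) => // pz; apply: nKp; rewrite pz.
Qed.

End Plane.

(** * Functions constant off a set of bounded size *)

(** The code [h] is injective on the exceptional points, so there are at most [#|C|] of them, a
    bound that does not depend on [f]. *)
Definition almost_constant (C : finType) (P V : Type) (f : P -> V) (v : V) :=
  exists h : P -> C, forall p q, f p <> v -> f q <> v -> h p = h q -> p = q.

(** If each [s m] were exceptional for some [k], pairing [k] with the code of [s m] would inject
    ['I_n] into [I * C]. *)
Lemma almost_constant_common (C I : finType) (P V : Type) (n : nat)
    (f : I -> P -> V) (v : I -> V) (s : 'I_n -> P) :
  (forall k, almost_constant C (f k) (v k)) -> injective s ->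
  (#|I| * #|C| < n)%N -> exists m, forall k, f k (s m) = v k.
Proof.
move=> /choice[h hP] s_inj; apply: contraPP => nom; apply/negP; rewrite -leqNgt.
have /choice[k kP] m : exists k, f k (s m) <> v k.
  apply: contrapT => nok; apply: nom; exists m => k.
  by apply: contrapT => ?; apply: nok; exists k.
have inj_kh : injective (fun m => (k m, h (k m) (s m))).
  move=> m m' [kk hh]; apply/s_inj/(hP (k m)) => //; first by rewrite kk.
  by rewrite [in RHS]kk.
by have := leq_card _ inj_kh; rewrite card_ord card_prod.
Qed.

Lemma almost_constant_unique (C : finType) (P V : Type) (f : P -> V) (v w : V) :
  infinite_set [set: P] -> almost_constant C f v -> almost_constant C f w ->
  v = w.
Proof.
move=> /infinite_set_seq[s [s_inj _]] fv fw.
have s_ord_inj : injective (fun k : 'I_(#|{: bool}| * #|C|).+1 => s k).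
  by move=> k l /s_inj/val_inj.
have ac (b : bool) : almost_constant C f (if b then v else w) by case: b.
have [m mP] := almost_constant_common ac s_ord_inj (ltnSn _).
by rewrite -(mP true) (mP false).
Qed.

(** * Colourings of the lines *)

Section Colouring.
Variables (P : Type) (PP : projective_plane P).
Hypothesis P_infinite : infinite_set [set: P].
Variables (C : finType) (V : Type) (col : set P -> C) (val : P -> V).
Hypothesis val_col : forall p q L K L' K',
  is_line PP L -> is_line PP K -> is_line PP L' -> is_line PP K' ->
  L <> K -> L' <> K' -> L p -> K p -> L' q -> K' q ->
  col L = col L' -> col K = col K' -> val p = val q.

Definition rich (i : C) (p : P) := exists L K,
  [/\ is_line PP L /\ is_line PP K, L <> K, L p /\ K p & col L = i /\ col K = i].

(** Infinitely many lines join [p] to the points of a line [L] missing [p], so two of them share a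
    colour; they are distinct, since a common line would be [L] itself. *)
Lemma rich_exists (p : P) : exists i, rich i p.
Proof.
have [L [lL nLp]] := line_off PP p.
have /choice[J JP] := line_throughP PP p.
have [x [y [Lx Ly nxy Jxy]]] :=
  infinite_set_pigeonhole (col \o J) (infinite_line P_infinite lL).
have [lJx Jxp Jxx] := JP x; have [lJy Jyp Jyy] := JP y.
exists (col (J x)), (J x), (J y); split=> // JJ; apply: nLp.
have -> // : L = J x.
by apply: (line_unique nxy lL lJx) => //; rewrite JJ.
Qed.

Lemma rich_val (i : C) (p q : P) : rich i p -> rich i q -> val p = val q.
Proof.
move=> [L [K [[? ?] ? [? ?] [cL cK]]]] [L' [K' [[? ?] ? [? ?] [cL' cK']]]].
by apply: (@val_col p q L K L' K') => //; rewrite ?cL ?cK.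
Qed.

(* The line joining [r] and [s] meets a second line of colour [i] at [r] and
   the line [K] of colour [i] at [s]. *)
Lemma wide_val (i : C) (r s : P) (K : set P) : rich i r ->
  is_line PP K -> col K = i -> ~ K r -> K s -> val s = val r.
Proof.
move=> [L1 [L2 [[l1 l2] n12 [L1r L2r] [c1 c2]]]] lK cK nKr Ks.
have [H [lH Hr Hs]] := line_throughP PP r s.
have nHK : K <> H by move=> KH; apply: nKr; rewrite KH.
(* At least one of the two lines of colour [i] through [r] differs from [H]. *)
have [H1|nH1] := pselect (L1 = H).
  apply: (@val_col s r K H L2 H) => //; last by rewrite cK.
  by rewrite -H1 => /esym.
by apply: (@val_col s r K H L1 H) => //; rewrite cK.
Qed.

Lemma val_almost_constant : exists v, almost_constant C val v.
Proof.
pose wide i := exists r K, [/\ rich i r, is_line PP K, col K = i & ~ K r].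
(* If [i] is not wide, both lines of colour [i] through [q] contain [p], so [p] is their meeting
   point [q]. *)
have nonwide i p q : ~ wide i -> rich i p -> rich i q -> p = q.
  move=> nw rp [L [K [[lL lK] nLK [Lq Kq] [cL cK]]]].
  apply: (meet_unique lL lK nLK) => //; apply: contrapT => nHp; apply: nw.
    by exists p, L.
  by exists p, K.
have /choice[h hP] := rich_exists.
(* Otherwise [h] would be injective from an infinite set to a finite one. *)
have [p0 wp0] : exists p0, wide (h p0).
  apply: contrapT => now; have [p [q [_ _ npq hpq]]] :=
    infinite_set_pigeonhole h P_infinite.
  apply: npq; apply: (@nonwide (h p)) => //; last by rewrite hpq.
  by move=> w; apply: now; exists p.
have wide_eq p : wide (h p) -> val p = val p0.
  move=> [r [K [rr lK cK nKr]]].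
  case: wp0 => r0 [K0 [rr0 lK0 cK0 nKr0]].
  (* The value at [s] equals the value of both wide colours. *)
  have [s [Ks K0s]] := meetP lK lK0.
  rewrite (rich_val (hP p) rr) (rich_val (hP p0) rr0).
  by rewrite -(wide_val rr lK cK nKr Ks) (wide_val rr0 lK0 cK0 nKr0 K0s).
(* Exceptional points have non-wide colours, and each such colour has at most one rich point, so [h]
   is a valid code. *)
exists (val p0), h => p q np nq hpq.
apply: (@nonwide (h p)) => //; last by rewrite hpq.
by move=> /wide_eq.
Qed.

End Colouring.

(** * Algebras and homomorphisms *)

Section AlgebraFacts.
Variable S : signature.

Lemma hom_eval (A B : algebra S) (phi : A -> B) (V : Type) (v : V -> A)
    (t : term S V) : is_hom phi -> phi (eval v t) = eval (phi \o v) t.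
Proof.
move=> phi_hom; elim: t => //= o ts ih.
by rewrite phi_hom; congr (interp B o); apply/funext => k; exact: ih.
Qed.

Lemma hom_binary (A B : algebra S) (phi : A -> B) (t : term S 'I_2) (x y : A) :
  is_hom phi -> phi (binary_term_op t x y) = binary_term_op t (phi x) (phi y).
Proof.
move=> phi_hom; rewrite /binary_term_op hom_eval //.
by congr (eval _ t); apply/funext => i /=; case: ifP.
Qed.

Lemma generated_subuniverse (A : algebra S) (X : set A) :
  subuniverse (generated X).
Proof. by move=> o x Gx U [hU XU]; apply: (hU) => k; exact: (Gx k U). Qed.

Lemma ISP_embedding (N A : algebra S) : ISP N A ->
  exists (I : Type) (phi : A -> power I N), is_hom phi /\ injective phi.
Proof.
move=> [I [U [hU [_ [phi [phi_hom phi_bij]]]]]].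
exists I, (fun a => set_val (phi a)); split.
  by move=> o x; rewrite phi_hom.
by move=> a b /val_inj/(bij_inj phi_bij).
Qed.

Lemma embedding_ISP (N A : algebra S) (I : Type) (phi : A -> power I N) (a0 : A) :
  is_hom phi -> injective phi -> ISP N A.
Proof.
move=> phi_hom phi_inj; pose U := range phi.
have hU : subuniverse (U : set (power I N)).
  move=> o x /(_ _)/cid2-/all_sig2[y _ yx].
  by exists (interp A o y) => //; rewrite phi_hom; congr (interp _ o); apply/funext.
exists I, U, hU; split; first by exists (phi a0), a0.
pose psi a : subalgebra hU := exist _ (phi a) (mem_set (imageT phi a)).
exists psi; split.
  by move=> o x; apply: val_inj; rewrite /= phi_hom.
rewrite -setTT_bijective; split=> [//|a b _ _ /(congr1 val)/phi_inj //|].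
by move=> [y yU] _; have [a _ ay] := set_mem yU; exists a => //; apply: val_inj.
Qed.

Lemma ISP_sub_power (N M : algebra S) (I : Type) (U : set (power I M))
    (hU : subuniverse U) : ISP N M -> U !=set0 -> ISP N (subalgebra hU).
Proof.
move=> /ISP_embedding[J [phi [phi_hom phi_inj]]] [u Uu].
pose psi (x : subalgebra hU) : power (I * J) N := fun ij => phi (val x ij.1) ij.2.
apply: (@embedding_ISP _ _ _ psi (exist _ u (mem_set Uu))).
  move=> o x; apply/funext => -[i j] /=.
  by rewrite /psi /= phi_hom.
move=> x y /(congr1 (fun z i j => z (i, j))) /= xy.
apply: val_inj; apply/funext => i; apply: phi_inj; apply/funext => j.
exact: (congr1 (fun z => z i j) xy).
Qed.

End AlgebraFacts.

(** * Ghost elements *)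

Section LocalEvaluation.
Variables (S : signature) (N : algebra S) (E : alter_ego N) (A : algebra S).

(* The first condition is compatibility with the structure, as symbols have finite
   arity; the second is continuity for the topology of pointwise convergence. *)
Lemma local_evaluation_cont_hom (G : dual E A -> N) :
  (forall (I : finType) (x : I -> dual E A),
     exists a : A, forall k, G (x k) = val (x k) a) ->
  (forall x, exists (n : nat) (F : 'I_n -> A), forall y : dual E A,
     (forall k, val y (F k) = val x (F k)) -> G y = G x) ->
  cont_hom_set G.
Proof.
move=> Gloc Gcont; split.
  move=> x; have G_filter : Filter (G @ x).
    exact: (@fmap_filter _ _ G _ (@nbhs_filter (dual E A) x)).
  apply: (iffRL (@discrete_cvg (discrete_topology {classic N}) (G @ x) (G x)
    G_filter)).
  have [n [F FP]] := Gcont x.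
  have near_eq k : nbhs x [set y : dual E A | val y (F k) = val x (F k)].
    have [ev_cont _] := @evaluation_subproof S N E A (F k).
    apply: (ev_cont x [set val x (F k)]).
    exact: (@discrete_set1 (discrete_topology {classic N})).
  have x_filter : Filter (nbhs x) := @nbhs_filter (dual E A) x.
  by apply: filterS (filter_forall _ near_eq) => y; exact: FP.
split=> [s x|s x|s x rx].
(* The index [None] carries the result of the operation, so a single [a] represents [G] at the
   arguments and at the result. *)
- have [a aP] := Gloc _ (fun k => oapp x (struct_op (dual E A) s x) k).
  have [_ [evF _ _]] := @evaluation_subproof S N E A a.
  rewrite (aP None) [LHS]evF; congr (ego_fop _).
  by apply/funext => k; rewrite /= -(aP (Some k)).
- have [a aP] := Gloc _ (fun k => oapp (val x) (struct_pop (dual E A) s x) k).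
  have [_ [_ evP _]] := @evaluation_subproof S N E A a.
  have [y [yE yP]] := evP s x; exists y; rewrite (aP None) yP yE; split=> //.
  by apply/funext => k; rewrite /= -(aP (Some k)).
- have [a aP] := Gloc _ x.
  have [_ [_ _ evR]] := @evaluation_subproof S N E A a.
  suff -> : G \o x = (fun z : dual E A => val z a) \o x by exact: evR.
  by apply/funext => k; exact: aP.
Qed.

Lemma duality_limit (P : Type) (C : finType) (g : P -> A) :
  infinite_set [set: P] -> yields_duality E A ->
  (forall x : A -> N, is_hom x -> exists v, almost_constant C (x \o g) v) ->
  exists a : A, forall (x : A -> N) (v : N),
    is_hom x -> almost_constant C (x \o g) v -> x a = v.
Proof.
move=> P_infinite [_ [inv _ evK]] g_ac.
have [s [s_inj _]] := infinite_set_seq P_infinite.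
have /choice[G GP] (x : dual E A) : exists v, almost_constant C (val x \o g) v.
  by apply: g_ac; exact: (set_valP x).
have s_ord_inj n : injective (fun k : 'I_n => s k).
  by move=> k l /s_inj/val_inj.
have G_cont_hom : cont_hom_set (G : dual E A -> N).
  apply: local_evaluation_cont_hom => [I x|x].
    have [m mP] := almost_constant_common (fun k => GP (x k))
      (@s_ord_inj (#|I| * #|C|).+1) (ltnSn _).
    by exists (g (s m)) => k; rewrite -mP.
  (* Among [2 * #|C| + 1] points one is ordinary for both [x] and [y]; these test points are fixed
     before [y], which gives continuity. *)
  exists (#|{: bool}| * #|C|).+1, (fun k => g (s k)) => y yx.
  have [m mP] := almost_constant_common (fun b : bool => GP (if b then x else y))
    (@s_ord_inj _) (ltnSn _).
  by rewrite -(mP false) -(mP true) /= yx.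
exists (inv (exist _ G (mem_set G_cont_hom))) => x v x_hom xv.
pose x' : dual E A := exist _ (x : structure_power A (ego_structure E)) (mem_set x_hom).
have := congr1 (fun z => val z x') (evK (exist _ G (mem_set G_cont_hom))).
by move=> /= ->; exact: almost_constant_unique P_infinite (GP x') xv.
Qed.

End LocalEvaluation.

(** * Line tuples and the ghost element *)

Lemma line_tuple_point (P M : Type) (u v : M) (L : set P) (q : P) :
  line_tuple u v L (Some q) = if q \in L then u else v.
Proof.
congr (if _ then u else v); apply/idP/idP => /set_mem.
  by move=> [[p Lp [<-]]|//]; exact: mem_set.
by move=> Lq; apply/mem_set; left; exists q.
Qed.

Lemma line_tuple_infty (P M : Type) (u v : M) (L : set P) :
  line_tuple u v L None = u.
Proof. by rewrite /line_tuple mem_set //; right. Qed.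

Theorem theorem3p1 (P : Type) (PP : projective_plane P)
    (P_infinite : infinite_set [set: P])
    (S : signature) (M : algebra S) (M_finite : finite_algebra M)
    (t : term S 'I_2) (a b c d e f : M)
    (mul_ac : binary_term_op t a c = e)
    (mul_ad : binary_term_op t a d = f)
    (mul_bc : binary_term_op t b c = f)
    (mul_bd : binary_term_op t b d = f)
    (g : power (option P) M)
    (g_infty : g None = e)
    (g_point : forall q : P, g (Some q) = f)
    (g_notin : ~ generated
        ([set line_tuple a b L | L in is_line PP] `|`
         [set line_tuple c d L | L in is_line PP] : set (power (option P) M)) g) :
  inherently_nondualisable M.
Proof.
move=> N [N_fin _] [E E_dual] NM; apply: g_notin.
set X : set (power (option P) M) := (X in generated X).
pose A := subalgebra (@generated_subuniverse _ _ X).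
have [L0 lL0] : exists L, is_line PP L.
  have [p _] := infinite_setN0 P_infinite.
  by have [L [lL _ _]] := line_throughP PP p p; exists L.
have lift (k : set P -> power (option P) M) :
    (forall L, is_line PP L -> X (k L)) ->
    exists K : set P -> A, forall L, is_line PP L -> val (K L) = k L.
  move=> kX; have kU L : is_line PP L -> generated X (k L).
    by move=> lL V [_ XV]; exact/XV/kX.
  (* Sets that are not lines receive the default [k L0], which makes [K] total. *)
  have /choice[K KE] L : exists y : A, is_line PP L -> val y = k L.
    have [lL|nlL] := pselect (is_line PP L).
      by exists (exist _ (k L) (mem_set (kU _ lL))).
    by exists (exist _ (k L0) (mem_set (kU _ lL0))).
  by exists K.
have [B BE] : exists B : set P -> A,
    forall L, is_line PP L -> val (B L) = line_tuple a b L.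
  by apply: lift => L lL; left; exists L.
have [D DE] : exists D : set P -> A,
    forall L, is_line PP L -> val (D L) = line_tuple c d L.
  by apply: lift => L lL; right; exists L.
have A_ISP : ISP N A.
  by apply: ISP_sub_power => //; exists (val (B L0)); exact: set_valP.
have proj_hom i : is_hom (fun y : A => (val y : power _ M) i) by [].
pose h (p : P) : power (option P) M := fun i =>
  if i is Some q then (if pselect (q = p) then e else f) else e.
have BDE p L K : is_line PP L -> is_line PP K -> L <> K -> L p -> K p ->
    val (binary_term_op t (B L) (D K)) = h p.
  move=> lL lK nLK Lp Kp; apply/funext => i.
  rewrite (hom_binary _ _ _ (proj_hom i)) BE // DE // /h.
  case: i => [q|].
    rewrite !line_tuple_point; case: pselect => [qp|nqp] /=.
      by rewrite qp !mem_set.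
    have [Lq|nLq] := pselect (L q); last first.
      by rewrite (memNset nLq); case: ifP.
    have [Kq|nKq] := pselect (K q); last first.
      by rewrite (memNset nKq) (mem_set Lq).
    by case: nqp; apply: (meet_unique lL lK).
  by rewrite !line_tuple_infty.
have /choice[w wP] (p : P) : exists y : A, val y = h p.
  have [L [lL Lp _]] := line_throughP PP p p.
  have [u [nLu _]] := point_off_lines lL lL.
  have [K [lK Kp Ku]] := line_throughP PP p u.
  exists (binary_term_op t (B L) (D K)); apply: BDE => // LK.
  by apply: nLu; rewrite LK.
have [n [nu nu_inj]] := finite_set_ord_inj N_fin.
pose C := ('I_n * 'I_n)%type.
have w_ac (x : A -> N) : is_hom x -> exists v, almost_constant C (x \o w) v.
  (* Both values are recorded because a line may supply either the left or the right factor. *)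
  move=> x_hom; pose col L := (nu (x (B L)), nu (x (D L))).
  have x_w p L K : is_line PP L -> is_line PP K -> L <> K -> L p -> K p ->
      x (w p) = binary_term_op t (x (B L)) (x (D K)).
    move=> lL lK nLK Lp Kp; rewrite -(hom_binary _ _ _ x_hom).
    by congr x; apply: val_inj; rewrite wP (BDE p).
  apply: (val_almost_constant (PP := PP) (col := col) P_infinite) => p q L K L' K'.
  move=> lL lK lL' lK' nLK nLK' Lp Kp L'q K'q [/nu_inj xB _] [_ /nu_inj xD].
  by rewrite /= (x_w p L K) // (x_w q L' K') // xB xD.
have [u uP] := duality_limit P_infinite (E_dual A A_ISP) w_ac.
suff -> : g = val u by exact: set_valP.
have [J [phi [phi_hom phi_inj]]] := ISP_embedding NM.
apply/funext => i; apply: phi_inj; apply/funext => j; symmetry.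
(* Coordinate [i] followed by component [j] of an embedding of [M] in a power of [N] is a
   homomorphism to [N]; such maps separate the tuples. *)
apply: (uP (fun x => phi (val x i) j)).
  by move=> o x; rewrite proj_hom phi_hom.
(* A constant code suffices: at coordinate [Some r] only the point [r] can be exceptional, and at
   infinity none is. *)
exists (fun=> (nu (phi e j), nu (phi e j))) => p q /=.
rewrite !wP /h; case: i => [r|]; last by rewrite g_infty.
by rewrite g_point; case: pselect => [rp|] //=; case: pselect => [rq|] //=; rewrite -rp.
Qed.
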